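(* For any $n\in\mathbb N_0$, the following identities for the Stieltjes–Wigert polynomials hold: $$\nabla_nS_n(x;q)=-q^nx\,S_{n-1}(qx;q),$$ $$S_n(x;q)+q^{-n-1}\Delta_nS_n(x;q)=S_{n+1}(x/q;q),$$ $$S_n(x;q)-(1-q^{-n})\nabla_nS_n(x;q)=S_n(x/q;q).$$
   Context: $\mathbb N_0=\{0,1,2,\dots\}$; $q$ is a complex parameter and $(a;q)_n=(1-a)(1-aq)\cdots(1-aq^{n-1})$. The Stieltjes–Wigert polynomials are (in this normalization) $$S_n(x;q)={}_1\phi_1(q^{-n};0;q,-q^{n+1}x)=\sum_{j=0}^n\frac{(q^{-n};q)_j}{(q;q)_j}(-1)^jq^{\binom j2}(-q^{n+1}x)^j ,$$ with the convention that the polynomial of index $-1$ is $0$. $\Delta_nf(n)=f(n+1)-f(n)$ and $\nabla_nf(n)=f(n)-f(n-1)$ act on the index $n$ with $x,q$ fixed.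
   Formalization: The first identity is stated only for n ≥ 1, since at n = 0 with the convention that the polynomial of index −1 is 0 its sides are 1 and 0; q is taken nonzero with q^k ≠ 1 for 1 ≤ k ≤ n+1 so that the polynomials are defined. *)

(* Defs.v *)
From HB Require Import structures.
From mathcomp Require Import all_boot all_order all_algebra.
From mathcomp Require Import reals.
From mathcomp Require Import complex.
Set Implicit Arguments.
Unset Strict Implicit.
Unset Printing Implicit Defensive.
Import Order.TTheory GRing.Theory Num.Theory.
Local Open Scope ring_scope.

Definition qpoch (F : fieldType) (a q : F) (n : nat) : F :=
  \prod_(i < n) (1 - a * q ^+ i).

(* The terminating series 1phi1(q^-n; 0; q, - q^(n+1) x); the denominator
   factor (0; q)_j is 1.  Meaningful when q != 0 and (q; q)_j != 0 for all
   j <= n, i.e. when q ^+ k != 1 for 0 < k <= n. *)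
Definition stieltjes_wigert_nat (F : fieldType) (n : nat) (x q : F) : F :=
  \sum_(j < n.+1)
     qpoch (q ^- n) q j / qpoch q q j
     * (-1) ^+ j * q ^+ 'C(j, 2) * (- (q ^+ n.+1 * x)) ^+ j.

(* Integer index, so that the backward difference at 0 refers to the polynomial
   of index -1, which is 0 by convention. *)
Definition stieltjes_wigert (F : fieldType) (n : int) (x q : F) : F :=
  match n with
  | Posz m => stieltjes_wigert_nat m x q
  | Negz _ => 0
  end.

Definition fdiff (V : zmodType) (f : int -> V) (n : int) : V := f (n + 1) - f n.

Definition bdiff (V : zmodType) (f : int -> V) (n : int) : V := f n - f (n - 1).

(* Main.v *)
Require Import Defs.
From HB Require Import structures.
From mathcomp Require Import all_boot all_order all_algebra.
From mathcomp Require Import reals.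
From mathcomp Require Import complex.
From mathcomp Require Import ring.
Set Implicit Arguments.
Unset Strict Implicit.
Unset Printing Implicit Defensive.
Import Order.TTheory GRing.Theory Num.Theory.
Local Open Scope ring_scope.

(** Clearing the negative powers of q against the powers of q^(n+1) in the
    series gives
      S_n(x) = sum_j a_(n,j) q^(binom(j+1,2)) x^j,
      a_(n,j) = prod_(i<j) (q^n - q^i) / (q;q)_j,
    and a_(n,j) = 0 for j > n, so that the sum may be extended at will and
    polynomials of different indices compared term by term.  Up to sign and a
    power of q, a_(n,j) is a Gaussian binomial coefficient; two relations hold
    between neighbours, the q-Pascal rule and the absorption rule
      a_(n+1,j+1) - a_(n,j+1) = - q^n a_(n,j),
      (1 - q^(j+1)) a_(n+1,j+1) = - (1 - q^(n+1)) q^j a_(n,j).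
    Summed over j, they become [sw_pascal] and [sw_absorption]:
      S_(n+1)(x) - S_n(x) = - q^(n+1) x S_n(qx),
      S_(n+1)(x/q) - S_(n+1)(x) = - (1 - q^(n+1)) x S_n(qx).
    The first identity of the theorem is the first of these.  Eliminating
    x S_n(qx) between the two gives the third identity at index n+1 (at index 0
    it is trivial), and adding them gives
    S_(n+1)(x/q) = S_n(x) - x S_n(qx), which is the second. *)

(** The product (q^-n; q)_j with q^-n cleared from each factor; it is the form
    in which a shift of n acts by a simple factor. *)
Definition qfall (F : fieldType) (q : F) (n j : nat) : F :=
  \prod_(i < j) (q ^+ n - q ^+ i).

Definition sw_coef (F : fieldType) (q : F) (n j : nat) : F :=
  qfall q n j / qpoch q q j.

Section StieltjesWigert.

Variables (F : fieldType) (q : F).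
Hypothesis q_neq0 : q != 0.

Lemma qfallSr n j : qfall q n j.+1 = qfall q n j * (q ^+ n - q ^+ j).
Proof. by rewrite /qfall big_ord_recr. Qed.

(** Every factor with i > 0 of the product at n+1 is q times the factor with
    i - 1 of the product at n. *)
Lemma qfallSS n j :
  qfall q n.+1 j.+1 = (q ^+ n.+1 - 1) * q ^+ j * qfall q n j.
Proof.
rewrite /qfall big_ord_recl expr0 -mulrA; congr (_ * _).
under eq_bigr => i _ do rewrite lift0 !exprS -mulrBr.
by rewrite big_split /= prodr_const card_ord.
Qed.

Lemma qfall_eq0 n j : (n < j)%N -> qfall q n j = 0.
Proof.
by move=> lt_nj; apply/eqP/prodf_eq0; exists (Ordinal lt_nj); rewrite ?subrr.
Qed.

Lemma qpochSr a j : qpoch a q j.+1 = qpoch a q j * (1 - a * q ^+ j).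
Proof. by rewrite /qpoch big_ord_recr. Qed.

Lemma qpoch_qfall n j : qpoch (q ^- n) q j * q ^+ n ^+ j = qfall q n j.
Proof.
elim: j => [|j IHj]; first by rewrite /qpoch /qfall !big_ord0 mulr1.
by rewrite qfallSr -IHj qpochSr exprS; field; rewrite expf_neq0.
Qed.

Lemma qpoch_neq0 N j : (forall k, (0 < k <= N)%N -> q ^+ k != 1) ->
  (j <= N)%N -> qpoch q q j != 0.
Proof.
move=> q_nonroot le_jN; apply/prodf_neq0 => i _.
by rewrite -exprS subr_eq0 eq_sym q_nonroot //= (leq_trans (ltn_ord i)).
Qed.

(** The upper bound is free because the coefficients vanish beyond n; two
    polynomials of different indices can thus be written over one range. *)
Lemma stieltjes_wigert_natE N n x : (n < N)%N ->
  stieltjes_wigert_nat n x q =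
  \sum_(j < N) sw_coef q n j * q ^+ 'C(j.+1, 2) * x ^+ j.
Proof.
move=> lt_nN; rewrite /stieltjes_wigert_nat.
rewrite (big_ord_widen N (fun j => qpoch (q ^- n) q j / qpoch q q j
  * (-1) ^+ j * q ^+ 'C(j, 2) * (- (q ^+ n.+1 * x)) ^+ j) lt_nN) big_mkcond.
apply: eq_bigr => j _; case: ltnP => [_|lt_nj]; last first.
  by rewrite /sw_coef qfall_eq0 // !mul0r.
have sgnE (y : F) : (-1) ^+ j * (- y) ^+ j = y ^+ j.
  by rewrite -exprMn mulN1r opprK.
rewrite (mulrAC _ _ (q ^+ _)) -[LHS]mulrA sgnE /sw_coef -qpoch_qfall.
by rewrite binS bin1 exprD exprMn [q ^+ n.+1]exprS exprMn; ring.
Qed.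

(** Split off the first factor of qfall at n+1 and the last factor at n: both
    terms become multiples of qfall q n j, and the multipliers
    q^(n+j+1) - q^j and q^n - q^j differ by - q^n (1 - q^(j+1)), whose second
    factor is the last one of (q; q)_(j+1). *)
Lemma sw_coef_pascal n j : qpoch q q j.+1 != 0 ->
  sw_coef q n.+1 j.+1 - sw_coef q n j.+1 = - (q ^+ n * sw_coef q n j).
Proof.
rewrite /sw_coef qfallSS qfallSr qpochSr mulf_eq0 negb_or => /andP[nz1 nz2].
by rewrite !exprS; field; rewrite nz1 nz2.
Qed.

(** The analogue of (j+1) binom(n+1, j+1) = (n+1) binom(n, j). *)
Lemma sw_coef_absorption n j : qpoch q q j.+1 != 0 ->
  (1 - q ^+ j.+1) * sw_coef q n.+1 j.+1
  = - ((1 - q ^+ n.+1) * q ^+ j * sw_coef q n j).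
Proof.
rewrite /sw_coef qfallSS qpochSr mulf_eq0 negb_or => /andP[nz1 nz2].
by rewrite !exprS; field; rewrite nz1 nz2.
Qed.

Lemma sw_coef0 n : sw_coef q n 0 = 1.
Proof. by rewrite /sw_coef /qfall /qpoch !big_ord0 divr1. Qed.

Variables (n : nat) (x : F).
Hypothesis q_nonroot : forall k : nat, (0 < k <= n.+1)%N -> q ^+ k != 1.

(** The q-Pascal rule for coefficients, summed: the constant terms cancel and
    the weight binom(j+2,2) = binom(j+1,2) + j + 1 turns x^(j+1) into
    q x (qx)^j. *)
Lemma sw_pascal :
  stieltjes_wigert_nat n.+1 x q - stieltjes_wigert_nat n x q
  = - (q ^+ n.+1 * x * stieltjes_wigert_nat n (q * x) q).
Proof.
rewrite !(@stieltjes_wigert_natE n.+2 _ x) // (@stieltjes_wigert_natE n.+1) //.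
rewrite -sumrB big_ord_recl !sw_coef0 subrr add0r mulr_sumr -sumrN.
apply: eq_bigr => j _; rewrite lift0 -2!mulrBl sw_coef_pascal; last first.
  exact: qpoch_neq0 q_nonroot _.
by rewrite [in LHS]binS bin1 exprD exprMn !exprS; ring.
Qed.

(** Passing from x to x/q multiplies the term of degree j+1 by q^-(j+1), and
    the factor q^-(j+1) - 1 of the difference is what absorption consumes. *)
Lemma sw_absorption :
  stieltjes_wigert_nat n.+1 (x / q) q - stieltjes_wigert_nat n.+1 x q
  = - ((1 - q ^+ n.+1) * x * stieltjes_wigert_nat n (q * x) q).
Proof.
rewrite !(@stieltjes_wigert_natE n.+2 n.+1) // (@stieltjes_wigert_natE n.+1) //.
rewrite -sumrB big_ord_recl !expr0 subrr add0r mulr_sumr -sumrN.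
apply: eq_bigr => j _; rewrite lift0.
have nz : qpoch q q j.+1 != 0 by exact: qpoch_neq0 q_nonroot _.
rewrite [in LHS]binS bin1 exprD.
transitivity ((1 - q ^+ j.+1) * sw_coef q n.+1 j.+1
              * q ^+ 'C(j.+1, 2) * x ^+ j.+1).
  by rewrite expr_div_n; field; rewrite expf_neq0.
by rewrite sw_coef_absorption // exprMn [x ^+ j.+1]exprS; ring.
Qed.

End StieltjesWigert.

(* The first identity is stated for n >= 1: with S_{-1} = 0 its two sides at
   n = 0 are 1 and 0. *)
Theorem lemma4p21 (R : realType) (q x : R[i]) (n : nat)
  (q_neq0 : q != 0)
  (q_nonroot : forall k : nat, (0 < k <= n.+1)%N -> q ^+ k != 1) :
  [/\ (0 < n)%N ->
        bdiff (fun m => stieltjes_wigert m x q) n%:Z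
        = - (q ^+ n * x * stieltjes_wigert (n%:Z - 1) (q * x) q),
      stieltjes_wigert n%:Z x q
        + q ^- n.+1 * fdiff (fun m => stieltjes_wigert m x q) n%:Z
        = stieltjes_wigert (n%:Z + 1) (x / q) q
    & stieltjes_wigert n%:Z x q
        - (1 - q ^- n) * bdiff (fun m => stieltjes_wigert m x q) n%:Z
        = stieltjes_wigert n%:Z (x / q) q].
Proof.
have predE (m : nat) : m.+1%:Z - 1 = m%:Z by rewrite -addn1 PoszD addrK.
have nzX k : q ^+ k != 0 by rewrite expf_neq0.
split; rewrite /bdiff /fdiff.
- case: n q_nonroot => // m nonroot _; rewrite predE /=.
  by apply: sw_pascal => // k /andP[k0 km]; rewrite nonroot // k0 leqW.
(* Both sides reduce to S_n(x) - x S_n(qx). *)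
- rewrite -PoszD addn1 /= (sw_pascal q_neq0 x q_nonroot).
  rewrite -[RHS](subrK (stieltjes_wigert_nat n.+1 x q)).
  rewrite (sw_absorption q_neq0 x q_nonroot).
  rewrite -[in RHS](subrK (stieltjes_wigert_nat n x q)
                          (stieltjes_wigert_nat n.+1 x q)).
  rewrite (sw_pascal q_neq0 x q_nonroot).
  by field.
- case: n q_nonroot => [|m] nonroot.
    by rewrite expr0 invr1 subrr mul0r subr0 /= /stieltjes_wigert_nat !big_ord1.
  have nonroot_m k : (0 < k <= m.+1)%N -> q ^+ k != 1.
    by case/andP=> k0 km; rewrite nonroot // k0 leqW.
  rewrite predE /= (sw_pascal q_neq0 x nonroot_m).
  rewrite -[RHS](subrK (stieltjes_wigert_nat m.+1 x q)).
  rewrite (sw_absorption q_neq0 x nonroot_m).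
  by field.
Qed.
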